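(* Let $G$ be an Abelian group of order $v$, let $D\subseteq G$ be a $k$-subset with difference levels $\mu_1<\cdots<\mu_s$, and let $A$ be the $v\times v$ incidence matrix of the symmetric incidence structure $(G,\operatorname{Dev}D)$. Suppose $k\equiv\mu_1\equiv\cdots\equiv\mu_s\pmod 2$. (1) If $k$ is even, the binary code of length $v$ with generator matrix $A$ is self-orthogonal. (2) If $k$ is odd, the matrix obtained from $A$ by prepending an all-one column generates a binary self-orthogonal code of length $v+1$.
   Context: $D$ has difference levels $\mu_1<\cdots<\mu_s$ if there are integers $t_i$ such that the multiset $\{g-h\mid g,h\in D\}$ contains exactly $t_i$ elements of $G\setminus\{0\}$ each with multiplicity $\mu_i$. $\operatorname{Dev}D=\{D+g\mid g\in G\}$. The incidence matrix has rows indexed by points and columns by blocks. A binary linear code $C$ is self-orthogonal if $C\subseteq C^\perp$ with respect to the standard inner product over $\mathbb F_2$; the code generated by a matrix is the row span over $\mathbb F_2$. *)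

(* Defs.v *)
From HB Require Import structures.
From mathcomp Require Import all_boot all_order all_algebra.
Set Implicit Arguments.
Unset Strict Implicit.
Unset Printing Implicit Defensive.
Import GRing.Theory.
Local Open Scope ring_scope.

Section DifferenceLevels.
Variable G : finZmodType.
Implicit Types (D : {set G}) (x g : G).

(* A sequence read as a multiset: multiplicities are given by count_mem. *)
Definition differences D : seq G := [seq g - h | g <- enum D, h <- enum D].

(* The last clause says that the t i elements of each level together exhaust
   the nonzero elements of G, so a nonzero element that is not a difference
   contributes the level 0. *)
Definition difference_levels D (s : nat) (mu : 'I_s -> nat) : Prop :=
  {homo mu : i j / (i < j)%N} /\
  exists t : 'I_s -> nat,
    (forall i, #|[set x : G | x != 0 & count_mem x (differences D) == mu i]|
               = t i) /\
    (\sum_i t i)%N = #|[set x : G | x != 0]|.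

(* Dev D as a family indexed by G, so that it has #|G| blocks even when some
   translates coincide. *)
Definition dev D g : {set G} := [set d + g | d in D].

End DifferenceLevels.

Definition incidence_mx (T : finType) (m n : nat)
    (pt : 'I_m -> T) (B : 'I_n -> {set T}) : 'M['F_2]_(m, n) :=
  \matrix_(i, j) (pt i \in B j)%:R.

Section BinaryCodes.
Variable n : nat.
Implicit Types (C : {set 'rV['F_2]_n}) (u w : 'rV['F_2]_n).

Definition code_of (m : nat) (M : 'M['F_2]_(m, n)) : {set 'rV['F_2]_n} :=
  [set u : 'rV['F_2]_n | (u <= M)%MS].

Definition inner u w : 'F_2 := \sum_i u 0 i * w 0 i.

Definition dual_code C : {set 'rV['F_2]_n} :=
  [set u | [forall w in C, inner u w == 0]].

Definition self_orthogonal C : bool := C \subset dual_code C.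

End BinaryCodes.

(* Main.v *)
(* The (p, q) entry of A A^T counts the ways of writing p - q as a difference
   of two elements of D, so it is k on the diagonal and some mu_i elsewhere;
   all of these are congruent to k mod 2. Hence A A^T = k J over F_2, which
   vanishes for k even; for k odd the all-one column adds another J. *)
Require Import Defs.
From mathcomp Require Import all_boot all_order all_algebra.
Import GRing.Theory.
Local Open Scope ring_scope.

Lemma innerE n (u w : 'rV['F_2]_n) : inner u w = (u *m w^T) 0 0.
Proof. by rewrite mxE; apply: eq_bigr => i _; rewrite mxE. Qed.

(** Codewords have the form [a *m M] and [b *m M], so their inner product is
    [a *m (M *m M^T) *m b^T]. *)
Lemma self_orthogonal_code_of m n (M : 'M['F_2]_(m, n)) :
  M *m M^T = 0 -> self_orthogonal (code_of M).
Proof.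
move=> MMt0; apply/subsetP => u; rewrite inE => /submxP[a ->].
rewrite inE; apply/forall_inP => w; rewrite inE => /submxP[b ->].
by rewrite innerE trmx_mul -mulmxA (mulmxA M) MMt0 mul0mx mulmx0 mxE.
Qed.

Lemma natr_F2 m : m%:R = (odd m)%:R :> 'F_2.
Proof. by apply: val_inj; rewrite /= !val_Fp_nat // !modn2 oddb. Qed.

Lemma in_dev (G : finZmodType) (D : {set G}) p g :
  (p \in dev D g) = (p - g \in D).
Proof.
apply/imsetP/idP => [[d dD ->]|pgD]; first by rewrite addrK.
by exists (p - g); rewrite ?subrK.
Qed.

(** A pair with [g - h = x] is determined by [h], since [g = x + h]. *)
Lemma count_differences (G : finZmodType) (D : {set G}) x :
  count_mem x (differences D) = #|[set h in D | x + h \in D]|.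
Proof.
rewrite -sum1_count big_mkcond big_allpairs_dep big_enum /=.
under eq_bigr => g _ do rewrite big_enum /=.
rewrite exchange_big -sum1_card /=.
under [RHS]eq_bigl => h do rewrite inE.
rewrite [RHS]big_mkcondr /=; apply: eq_bigr => h _.
under eq_bigr => g _ do rewrite subr_eq.
rewrite -big_mkcondr /=; case: ifP => xhD.
  by rewrite (big_pred1 (x + h)) // => g /=; case: eqP => [->|]; rewrite ?xhD ?andbF.
by rewrite big_pred0 // => g; case: eqP => [->|]; rewrite ?xhD ?andbF.
Qed.

Lemma card_dev_pair (G : finZmodType) (D : {set G}) p q :
  #|[set g | (p \in dev D g) && (q \in dev D g)]|
  = count_mem (p - q) (differences D).
Proof.
(* Substitute [h = q - g]: then [q - g] is [h] and [p - g] is [(p - q) + h]. *)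
have subqK : involutive (fun g : G => q - g) by move=> g; rewrite subKr.
rewrite count_differences -(card_imset _ (inv_inj subqK)).
apply: eq_card => h; rewrite (can_imset_pre _ subqK) !inE !in_dev subKr.
by rewrite opprB addrCA [h + _]addrC andbC.
Qed.

(** By cardinality: the levels are distinct, so the level sets are disjoint and their union has
    [\sum_i t i] elements. That is the number of nonzero elements, so the union contains all of
    them. *)
Lemma difference_levels_mem {G : finZmodType} {D : {set G}} {s}
    {mu : 'I_s -> nat} {x : G} :
  difference_levels D mu -> x != 0 ->
  exists i, count_mem x (differences D) = mu i.
Proof.
case=> mu_mono [t [tE sum_t]] x0; pose c y := count_mem y (differences D).
have mu_inj : injective mu.
  move=> i j eq_mu; apply: val_inj => /=.
  by case: (ltngtP i j) => // /mu_mono; rewrite eq_mu ltnn.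
pose S i := [set y : G | y != 0 & c y == mu i].
have cardS : #|\bigcup_i S i| = #|[set y : G | y != 0]|.
  rewrite -sum_t -sum1_card partition_disjoint_bigcup /=.
    by apply: eq_bigr => i _; rewrite sum1_card tE.
  move=> i j neq_ij; rewrite -setI_eq0; apply/eqP/setP => y; rewrite !inE.
  apply: contraNF neq_ij => /andP[/andP[_ /eqP ci] /andP[_ /eqP cj]].
  by apply/eqP/mu_inj; rewrite -ci -cj.
have subS : \bigcup_i S i \subset [set y : G | y != 0].
  by apply/bigcupsP => i _; apply/subsetP => y; rewrite !inE => /andP[].
have /eqP eqS : \bigcup_i S i == [set y : G | y != 0].
  by rewrite eqEcard subS cardS leqnn.
have : x \in \bigcup_i S i by rewrite eqS inE.
by case/bigcupP => i _; rewrite inE => /andP[_ /eqP]; exists i.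
Qed.

Lemma odd_count_differences {G : finZmodType} {D : {set G}} {s}
    {mu : 'I_s -> nat} (x : G) :
  difference_levels D mu -> (forall i, #|D| = mu i %[mod 2]) ->
  odd (count_mem x (differences D)) = odd #|D|.
Proof.
move=> hmu hpar; have [->|x0] := eqVneq x 0.
  (* The levels say nothing about 0, which arises once as [h - h] for each [h] in [D]. *)
  rewrite count_differences; congr (odd _).
  by apply: eq_card => h; rewrite inE add0r andbb.
have [i ->] := difference_levels_mem hmu x0.
by move: (hpar i); rewrite !modn2; do 2!case: odd.
Qed.

Lemma incidence_gram {G : finZmodType} {D : {set G}} {s} {mu : 'I_s -> nat}
    {m n} (pt : 'I_m -> G) (blk : 'I_n -> G) :
  difference_levels D mu -> (forall i, #|D| = mu i %[mod 2]) ->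
  bijective blk ->
  let A := incidence_mx pt (fun j => dev D (blk j)) in
  A *m A^T = const_mx (odd #|D|)%:R.
Proof.
move=> hmu hpar hblk A; apply/matrixP => i j; rewrite !mxE.
(* The constant is turned back into the number of [g] whose translate contains both points; over
   ['F_2] only its parity matters. *)
rewrite -(odd_count_differences (pt i - pt j) hmu hpar) -natr_F2.
rewrite -card_dev_pair -sum1_card natr_sum.
(* Each [g] labels exactly one column. *)
rewrite (reindex blk) /=; last exact: onW_bij.
rewrite [RHS]big_mkcond; apply: eq_bigr => l _.
by rewrite !mxE inE -natrM mulnb; case: ifP.
Qed.

Theorem theorem15 (G : finZmodType) (v k s : nat) (D : {set G})
    (mu : 'I_s -> nat) (pt blk : 'I_v -> G)
    (hv : #|G| = v) (hk : #|D| = k)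
    (hmu : difference_levels D mu)
    (hpt : bijective pt) (hblk : bijective blk)
    (hpar : forall i : 'I_s, k = mu i %[mod 2]) :
  let A := incidence_mx pt (fun j => dev D (blk j)) in
  (~~ odd k -> self_orthogonal (code_of A)) /\
  (odd k -> self_orthogonal (code_of (row_mx (const_mx 1 : 'cV['F_2]_v) A))).
Proof.
move=> A; rewrite -hk in hpar *.
have gramA : A *m A^T = const_mx (odd #|D|)%:R by apply: (incidence_gram _ _ hmu).
split=> [/negbTE even_k | odd_k]; apply: self_orthogonal_code_of.
  by rewrite gramA even_k; apply/matrixP => i j; rewrite !mxE.
rewrite tr_row_mx mul_row_col gramA odd_k; apply/matrixP => i j.
(* Every entry is [1 + 1], which is 0 in ['F_2]. *)
by rewrite !mxE big_ord1 !mxE mulr1; apply: val_inj.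
Qed.
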